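(* For the Tchebychev polynomials of the second kind $U_k(x)$ and every natural number $k\ge 1$ we have \[U_{k}(x)=\left|\begin{array}{rrrrrr} 2x&-1&0&\cdots&0&0\\ -1&2x&-1&\cdots&0&0\\ 0&-1&2x&\cdots&0&0\\ \vdots&\vdots&\vdots&\ddots&\vdots&\vdots\\ 0&0&0&\cdots&2x&-1\\ 0&0&0&\cdots&-1&2x\end{array}\right|,\] where the determinant has size $k$; that is, the matrix is the $k\times k$ tridiagonal matrix with all diagonal entries equal to $2x$ and all superdiagonal and subdiagonal entries equal to $-1$.
   Context: The Tchebychev (Chebyshev) polynomials of the second kind are defined by $U_0(x)=1$, $U_1(x)=2x$, and $U_k(x)=-U_{k-2}(x)+2xU_{k-1}(x)$ for $k\ge 2$. *)

(* Defs.v *)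
From mathcomp Require Import all_boot all_order all_algebra.

Set Implicit Arguments.
Unset Strict Implicit.
Unset Printing Implicit Defensive.

Import GRing.Theory.
Local Open Scope ring_scope.

(* U_k as a formal polynomial in 'X, over an arbitrary commutative ring of
   coefficients; R = int, or any field of numbers, is the classical case. *)
Fixpoint chebyshevU (R : comNzRingType) (k : nat) : {poly R} :=
  match k with
  | 0 => 1
  | 1 => 2 * 'X
  | (k1.+1 as k2).+1 => - chebyshevU R k1 + 2 * 'X * chebyshevU R k2
  end.

(* Main.v *)
Require Import Defs.
From mathcomp Require Import all_boot all_order all_algebra.
Set Implicit Arguments.
Unset Strict Implicit.
Unset Printing Implicit Defensive.
Import GRing.Theory.
Local Open Scope ring_scope.

(** The determinant d_n of the n x n tridiagonal matrix with constant bands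
    c (below), a (diagonal), b (above) obeys the three-term recurrence
    d_(n+2) = a d_(n+1) - b c d_n: this is [det_tridiag_rec], a double Laplace
    expansion. For a = 2X and b = c = -1 it is the recurrence that defines the
    polynomials U_k. The initial values agree too, as the empty determinant is
    1 = U_0 and the 1 x 1 determinant is 2X = U_1. *)

Definition tridiag (S : nzRingType) (c a b : S) (n : nat) : 'M[S]_n :=
  \matrix_(i < n, j < n)
    (if i == j then a else if i.+1 == j :> nat then b
     else if j.+1 == i :> nat then c else 0).

(** The bands are constant, so deleting the first row and the first column
    gives the same matrix in one size less. *)
Lemma tridiag_minor0 (S : nzRingType) (c a b : S) (n : nat) :
  row' ord0 (col' ord0 (tridiag c a b n.+1)) = tridiag c a b n.
Proof. by apply/matrixP=> i j; rewrite !mxE (inj_eq lift_inj). Qed.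

(** The first row is (a, b, 0, ..., 0). The minor of a is the matrix of size
    n+1; the minor of b has first column (c, 0, ..., 0), so that expanding it
    along this column leaves the matrix of size n. *)
Lemma det_tridiag_rec (S : comNzRingType) (c a b : S) (n : nat) :
  \det (tridiag c a b n.+2) =
  a * \det (tridiag c a b n.+1) - b * c * \det (tridiag c a b n).
Proof.
rewrite (expand_det_row _ ord0) 2!big_ord_recl big1 ?addr0; last first.
  by move=> j _; rewrite mxE mul0r.
rewrite /cofactor tridiag_minor0 !mxE /= expr0 expr1 mul1r.
congr (_ + _); rewrite mulN1r mulrN -mulrA; congr (- (_ * _)).
rewrite (expand_det_col _ ord0) big_ord_recl big1 ?addr0; last first.
  by move=> i _; rewrite !mxE mul0r.
rewrite /cofactor !mxE /= expr0 mul1r; congr (_ * \det _).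
(* Deleting row 0 and column 1, then row 0 and column 0 of the rest, amounts to
   deleting the first two rows and the first two columns. *)
by apply/matrixP=> i j; rewrite !mxE.
Qed.

Lemma chebyshevU_det_tridiag (R : comNzRingType) (k : nat) :
  chebyshevU R k = \det (tridiag (-1) (2 * 'X) (-1) k).
Proof.
(* The recurrence reaches two steps back, hence the induction on a pair of
   consecutive indices. *)
suff [] : chebyshevU R k = \det (tridiag (-1) (2 * 'X) (-1) k) /\
          chebyshevU R k.+1 = \det (tridiag (-1) (2 * 'X) (-1) k.+1) by [].
elim: k => [|k [IHk IHk1]]; first by rewrite det_mx00 det_mx11 mxE.
by split=> //; rewrite det_tridiag_rec -IHk -IHk1 mulrNN !mul1r addrC.
Qed.

Theorem proposition2p5 (R : comNzRingType) (k : nat) (hk : (1 <= k)%N) :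
  chebyshevU R k =
  \det (\matrix_(i < k, j < k)
          (if i == j then 2 * 'X
           else if (i.+1 == j :> nat) || (j.+1 == i :> nat) then -1
           else 0 : {poly R})).
Proof.
rewrite chebyshevU_det_tridiag; congr (\det _).
by apply/matrixP=> i j; rewrite !mxE; case: (i.+1 == j :> nat).
Qed.
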